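(* Let $M$ be a $C^\infty$-manifold diffeomorphic to $\mathbb{R}^n$, equipped with a complete Riemannian metric of bounded nonpositive sectional curvature, i.e. there is a constant $k$ such that $-k^2\le K\le 0$. Then every nonempty weakly convex closed subset $G$ of $M$ is connected and simply connected.
   Context: Let $d$ be the Riemannian distance on $M$. For a closed subset $G\subset M$ with complement $G^C=M\setminus G$, the projection onto $G$ is said to be unique if for every $x\in G^C$ there is exactly one point $y\in G$ with $d(x,y)=d(x,G)$; this point (which lies in $\partial G$) is denoted $\pi(x)$, giving a map $\pi:G^C\to\partial G$. For $x\in G^C$, let $\gamma:[0,\infty)\to M$ be the unit-speed geodesic ray with $\gamma(0)=\pi(x)$ passing through $x$; this ray is denoted $[\pi(x),x)$. The open horobowl (open horoball) associated with this ray is $\bigcup_{t>0}B(\gamma(t),t)$, where $B(p,r)$ is the open ball of center $p$ and radius $r$. A closed subset $G$ of $M$ is weakly convex if the projection onto $G$ is unique and, for every $x\in G^C$, the open horobowl associated with the ray $[\pi(x),x)$ does not intersect $G$ (i.e. every point of the ray other than its origin lies in $G^C$ and projects to $\pi(x)$). *)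

(* Defs.v *)
From mathcomp Require Export all_boot all_order all_algebra.
From mathcomp Require Export all_classical all_reals all_analysis.

Set Implicit Arguments.
Unset Strict Implicit.
Unset Printing Implicit Defensive.

Import Order.TTheory GRing.Theory Num.Theory.
Import numFieldNormedType.Exports.
Local Open Scope classical_set_scope.
Local Open Scope ring_scope.

Section LocalGeometry.
Context {R : realType} {n : nat}.
Local Notation E := 'rV[R]_n.

Definition partial (i : 'I_n) (f : E -> R) (p : E) : R :=
  'D_(delta_mx 0 i) f p.

Fixpoint Ck (k : nat) (f : E -> R) : Prop :=
  continuous f /\
  if k is k'.+1 then
    forall i, (forall p, derivable f p (delta_mx 0 i)) /\ Ck k' (partial i f)
  else True.

Definition smooth (f : E -> R) : Prop := forall k, Ck k f.

(* The metric tensor of a Riemannian metric in a global chart: [g p i j] is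
   g_ij at the point of coordinates [p]. *)
Record riemMetric := RiemMetric {
  metric :> E -> 'M[R]_n ;
  metric_smooth : forall i j, smooth (fun p => metric p i j) ;
  metric_sym : forall p, (metric p)^T = metric p ;
  metric_pos : forall p (v : E), v != 0 -> 0 < (v *m metric p *m v^T) 0 0 }.

Context (g : riemMetric).

Definition inner (p u v : E) : R := (u *m g p *m v^T) 0 0.

(* Gamma^k_ij *)
Definition christoffel (k i j : 'I_n) (p : E) : R :=
  2^-1 * \sum_(l < n) invmx (g p) k l *
    (partial i (fun q => g q j l) p + partial j (fun q => g q i l) p
     - partial l (fun q => g q i j) p).

(* The coefficient along the l-th coordinate field of R(d_i, d_j) d_k, where
   R(X, Y) Z = nabla_X nabla_Y Z - nabla_Y nabla_X Z - nabla_[X, Y] Z. *)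
Definition riemann (l k i j : 'I_n) (p : E) : R :=
  partial i (christoffel l j k) p - partial j (christoffel l i k) p
  + \sum_(m < n) (christoffel l i m p * christoffel m j k p
                  - christoffel l j m p * christoffel m i k p).

(* R(u, v) w *)
Definition curvature (p u v w : E) : E :=
  \row_l \sum_(i < n) \sum_(j < n) \sum_(k < n)
     riemann l k i j p * u 0 i * v 0 j * w 0 k.

Definition sectional (p u v : E) : R :=
  inner p (curvature p u v v) u
  / (inner p u u * inner p v v - inner p u v ^+ 2).

Definition sectional_between (a b : R) : Prop :=
  forall p u v : E, free [:: u; v] -> a <= sectional p u v <= b.

Definition C1 (c : R -> E) : Prop :=
  (forall t : R, derivable c t 1) /\ continuous (derive1 c).

(* Consecutive pieces agree at the break points, so [c] is continuous on
   [a, b]; each piece is the restriction to a closed interval of a C^1 map. *)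
Definition piecewise_C1 (a b : R) (c : R -> E) : Prop :=
  exists2 s : seq R, itv_partition a b s &
    forall i, (i < size s)%N ->
      exists2 e : R -> E, C1 e &
        {in `[nth b (a :: s) i, nth b s i], c =1 e}.

Definition speed (c : R -> E) (t : R) : R :=
  Num.sqrt (inner (c t) (derive1 c t) (derive1 c t)).

(* The break points, where [derive1 c] may be meaningless, are finitely many. *)
Definition arc_length (a b : R) (c : R -> E) : R :=
  \int[lebesgue_measure]_(t in `[a, b]) speed c t.

Definition geodesic_at (c : R -> E) (t : R) : Prop :=
  [/\ derivable c t 1, derivable (derive1 c) t 1 &
      forall k : 'I_n, derive1 (derive1 c) t 0 k =
        - \sum_(i < n) \sum_(j < n)
            christoffel k i j (c t) * derive1 c t 0 i * derive1 c t 0 j].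

End LocalGeometry.
Arguments riemMetric : clear implicits.

(* A smooth manifold diffeomorphic to R^n, presented by such a diffeomorphism
   [chart]: its smooth structure is the one of which [chart] is a chart. *)
Record globalChart (R : realType) (n : nat) (M : topologicalType) :=
  GlobalChart {
    chart :> M -> 'rV[R]_n ;
    chart_inv : 'rV[R]_n -> M ;
    chartK : cancel chart chart_inv ;
    chart_invK : cancel chart_inv chart ;
    chart_continuous : continuous chart ;
    chart_inv_continuous : continuous chart_inv }.

Section Riemannian.
Context {R : realType} {n : nat} {M : topologicalType}.
Context (phi : globalChart R n M) (g : riemMetric R n).

Definition rdist (x y : M) : R :=
  inf [set L | exists a b (c : R -> M),
    [/\ piecewise_C1 a b (phi \o c), c a = x, c b = y &
        L = arc_length g a b (phi \o c)]].

Definition rdist_set (x : M) (G : set M) : R := inf [set rdist x y | y in G].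

Definition rball (p : M) (r : R) : set M := [set y | rdist p y < r].

Definition rcomplete : Prop :=
  forall u : nat -> M,
    (forall e : R, 0 < e ->
       exists N, forall i j, (N <= i)%N -> (N <= j)%N -> rdist (u i) (u j) < e) ->
    exists l : M, rdist (u i) l @[i --> \oo] --> (0 : R).

(* Only the values of [c] on [0, +oo[ matter; being a geodesic on this closed
   half-line means extending as a geodesic slightly beyond the origin. *)
Definition unit_speed_ray (c : R -> M) : Prop :=
  (exists2 e : R, 0 < e & forall t : R, - e < t -> geodesic_at g (phi \o c) t) /\
  (forall t : R, 0 <= t -> speed g (phi \o c) t = 1).

Definition horobowl (c : R -> M) : set M :=
  \bigcup_(t in [set t : R | 0 < t]) rball (c t) t.

Definition is_projection (G : set M) (x y : M) : Prop :=
  G y /\ rdist x y = rdist_set x G.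

Definition unique_projection (G : set M) : Prop :=
  forall x, ~ G x -> exists! y, is_projection G x y.

(* [c] is the ray [y, x) from y = pi(x) through x. *)
Definition weakly_convex (G : set M) : Prop :=
  [/\ closed G, unique_projection G &
    forall x y (c : R -> M), ~ G x -> is_projection G x y ->
      unit_speed_ray c -> c 0 = y -> (exists2 t : R, 0 < t & c t = x) ->
      horobowl c `&` G = set0].

End Riemannian.

Section SimplyConnected.
Context (R : realType) {M : topologicalType}.

Definition path_in (G : set M) (x y : M) (f : R -> M) : Prop :=
  [/\ {within `[0, 1], continuous f}, f 0 = x, f 1 = y &
      {in `[0, 1], forall t, G (f t)}].

Definition path_connected (G : set M) : Prop :=
  forall x y, G x -> G y -> exists f, path_in G x y f.

(* Homotopy relative to the end points, through loops in [G]. *)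
Definition null_homotopic (G : set M) (x : M) (f : R -> M) : Prop :=
  exists H : R * R -> M,
    [/\ {within `[0, 1] `*` `[0, 1], continuous H},
        {in `[0, 1], forall s, path_in G x x (fun t => H (s, t))},
        {in `[0, 1], forall t, H (0, t) = f t} &
        {in `[0, 1], forall t, H (1, t) = x}].

Definition simply_connected (G : set M) : Prop :=
  path_connected G /\
  forall x f, path_in G x x f -> null_homotopic G x f.

End SimplyConnected.

(* Main.v *)
(* The nearest-point map [r : M -> G] is a continuous retraction of [M] onto [G],
   and a retract of the contractible space [M] is connected and simply connected.
   Continuity of [r] needs only the uniqueness of the projection and the
   compactness of closed bounded sets: a limit of nearest points is a nearest
   point. That compactness is the Hopf-Rinow theorem, which holds for every
   complete, locally compact length space (Cohn-Vossen), so no geodesic has to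
   be constructed. What remains is that the Riemannian distance is a length
   metric inducing the topology of [M]. *)

Require Import Defs.
From mathcomp Require Import measurable_realfun lra ring.
Set Implicit Arguments.
Unset Strict Implicit.
Unset Printing Implicit Defensive.

Import Order.TTheory GRing.Theory Num.Theory.
Import numFieldNormedType.Exports.
Local Open Scope classical_set_scope.
Local Open Scope ring_scope.

(** * Metric geometry: compactness of closed balls and nearest-point maps *)

Section MetricSpaces.
Context {R : realType} {T : topologicalType}.
Implicit Types (d : T -> T -> R) (x y z : T).

(** A pseudometric inducing the topology; that [rdist] separates points is [rdist_eq0]. *)
Record metrizes d : Prop := Metrizes {
  metrizes_ge0 : forall x y, 0 <= d x y ;
  metrizes_refl : forall x, d x x = 0 ;
  metrizes_sym : forall x y, d x y = d y x ;
  metrizes_triangle : forall x y z, d x z <= d x y + d y z ;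
  metrizes_nbhs : forall x (U : set T),
    nbhs x U <-> exists2 e : R, 0 < e & [set y | d x y < e] `<=` U }.

(** Approximate intermediate points stand for almost minimizing curves: they show that the ball of
    radius [r + s] lies in the [s]-neighbourhood of the ball of radius [r]. *)
Definition length_space d : Prop := forall x y (r s : R), 0 < r -> 0 < s ->
  d x y < r + s -> exists2 z, d x z < r & d z y < s.

Definition cauchy_complete d : Prop := forall u : nat -> T,
  (forall e : R, 0 < e -> exists N, forall i j,
     (N <= i)%N -> (N <= j)%N -> d (u i) (u j) < e) ->
  exists l, d (u i) l @[i --> \oo] --> (0 : R).

Definition precompact_set (A : set T) : Prop := exists2 K, compact K & A `<=` K.

Lemma precompact_setS (A B : set T) :
  A `<=` B -> precompact_set B -> precompact_set A.
Proof. by move=> AB [K cK BK]; exists K => //; exact: subset_trans BK. Qed.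

Section Metric.
Context {d : T -> T -> R} (md : metrizes d).

Lemma metrizes_ball x (e : R) : 0 < e -> \forall y \near x, d x y < e.
Proof. by move=> e0; apply: (metrizes_nbhs md x [set y | d x y < e]).2; exists e. Qed.

Lemma metrizes_continuous x : continuous (d x).
Proof.
move=> y; apply/cvgrPdist_lt => e e0; near=> z.
have dyz : d y z < e by near: z; exact: metrizes_ball.
have := metrizes_triangle md x y z; have := metrizes_triangle md x z y.
by rewrite (metrizes_sym md z y) ltr_norml; lra.
Unshelve. all: by end_near. Qed.

(* Cohn-Vossen's step. Otherwise the compact set of points within [r] of [q],
   [r] being almost maximal for [B(q, r)] to be precompact, would be covered by
   finitely many balls whose enlargements are precompact. *)
Lemma precompact_halving (q : T) (e : R) : length_space d ->
    (forall x, exists2 K, compact K & nbhs x K) -> 0 < e ->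
    ~ precompact_set [set y | d q y < e] ->
  exists2 z, d q z <= e & ~ precompact_set [set y | d z y < e / 2].
Proof.
move=> ld lc e0 nq; apply: contrapT => hz.
have {}hz z : d q z <= e -> precompact_set [set y | d z y < e / 2].
  by move=> qz; apply: contrapT => hn; apply: hz; exists z.
pose pc r := precompact_set [set y | d q y < r].
have [r0 r00 pr0] : exists2 r : R, 0 < r & pc r.
  have [K cK /(metrizes_nbhs md q K).1 [r r0 rK]] := lc q.
  by exists r => //; exists K.
(* Each round enlarges the radius by [e / 4], so four rounds from [r0 > 0] exceed [e]. *)
suff step (r : R) : 0 < r -> pc r -> pc (r + e / 4).
  have all_pc k : pc (r0 + (e / 4) *+ k).
    elim: k => [|k ih]; first by rewrite mulr0n addr0.
    rewrite mulrS [e / 4 + _]addrC addrA; apply: step => //.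
    by rewrite ltr_wpDr// mulrn_wge0//; lra.
  apply: nq; have := all_pc 4; apply: precompact_setS => y /= qy.
  by rewrite (lt_trans qy)// -[e / 4 *+ 4]mulr_natr; lra.
move=> r0' [K cK rK].
have [re|er] := ltP e r.
  exfalso; apply: nq; exists K => //.
  by apply: subset_trans rK => y /= /lt_trans; exact.
pose K' := K `&` [set z | d q z <= r].
have cK' : compact K'.
  apply: compact_closedI => //; apply: closed_comp (@closed_le R r) => z _.
  exact: metrizes_continuous.
(* Near covering along this filter of large compact sets stands for the
   extraction of a finite subcover. *)
pose F : set_system (set T) := [set S |
  exists2 K0, compact K0 & forall K1, compact K1 -> K0 `<=` K1 -> S K1].
have FF : Filter F.
  split.
  - by exists set0 => //; exact: compact0.
  - move=> P Q [K1 cK1 K1P] [K2 cK2 K2Q].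
    exists (K1 `|` K2); first exact: compactU.
    by move=> K3 cK3; rewrite subUset => -[K13 K23]; split; [exact: K1P|exact: K2Q].
  - by move=> P Q PQ [K0 cK0 K0P]; exists K0 => // K1 cK1 K01; exact/PQ/K0P.
have [K0 cK0 K0P] : \forall K0 \near F,
    K' `<=` (fun z => [set y | d z y < e / 4] `<=` K0).
  apply: (compact_near_coveringP K').1 => // z [_ /= qz].
  (* If [z'] is within [e / 4] of [z], the [e / 4]-ball about [z'] lies in the precompact
     [e / 2]-ball about [z]. *)
  have [Kz cKz zK] := hz z (le_trans qz er).
  have e4 : 0 < e / 4 by lra.
  exists ([set y | d z y < e / 4], [set K1 | Kz `<=` K1]) => /=.
    by split; [exact: metrizes_ball|exists Kz].
  move=> [z' K1] /= [zz' KK1] y /= z'y; apply/KK1/zK => /=.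
  by have := metrizes_triangle md z z' y; lra.
exists K0 => // y /= qy; have [|z qz zy] := ld _ _ _ _ r0' _ qy; first by lra.
by apply: (K0P K0 cK0 (subset_refl _) z) => //; split; [exact: rK|exact: ltW].
Qed.

(** From a ball that is not precompact, [precompact_halving] produces a sequence of such balls with
    halved radii. Their centres form a Cauchy sequence, and a compact neighbourhood of the limit
    contains the late balls, a contradiction. *)
Theorem cohn_vossen : length_space d -> cauchy_complete d ->
    (forall x, exists2 K, compact K & nbhs x K) ->
  forall x (r : R), precompact_set [set y | d x y < r].
Proof.
move=> ld cd lc p e; apply: contrapT => npe.
have e0 : 0 < e.
  rewrite ltNge; apply/negP => e0; apply: npe; exists set0 => [|y /= py].
    exact: compact0.
  by have := metrizes_ge0 md p y; lra.
pose bad := {qr : T * R | 0 < qr.2 /\ ~ precompact_set [set y | d qr.1 y < qr.2]}.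
pose next (s t : bad) :=
  d (sval s).1 (sval t).1 <= (sval s).2 /\ (sval t).2 = (sval s).2 / 2.
have next_ex s : {t | next s t}.
  apply: cid; case: s => -[q r] [/= r0 nqr].
  have [z qz nz] := precompact_halving ld lc r0 nqr.
  have r20 : 0 < r / 2 by lra.
  by exists (exist _ (z, r / 2) (conj r20 nz)).
have [f [f0 fS]] := dependent_choice next_ex (exist _ (p, e) (conj e0 npe)).
pose u k := (sval (f k)).1; pose ep k := (sval (f k)).2.
have epE k : ep k = e / 2 ^+ k.
  elim: k => [|k ih]; first by rewrite /ep f0 /= expr0 divr1.
  by rewrite /ep (fS k).2 -/(ep k) ih exprSr invfM mulrA.
have ep0 : ep k @[k --> \oo] --> (0 : R).
  rewrite (_ : ep = fun k => e * 2^-1 ^+ k); last first.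
    by apply/funext => k; rewrite epE exprVn.
  rewrite -[0](mulr0 e); apply: cvgM; first exact: cvg_cst.
  by apply: cvg_expr; rewrite ger0_norm; lra.
have ep_gt0 k : 0 < ep k by have [] := svalP (f k).
have uD k m : d (u k) (u (k + m)%N) <= 2 * ep k.
  (* The sharper bound telescopes: a step of length at most [ep j] equals the drop
     [2 * ep j - 2 * ep j.+1]. *)
  suff : d (u k) (u (k + m)%N) <= 2 * ep k - 2 * ep (k + m)%N.
    by have := ep_gt0 (k + m)%N; lra.
  elim: m => [|m ih]; first by rewrite addn0 (metrizes_refl md); lra.
  rewrite addnS; have := metrizes_triangle md (u k) (u (k + m)%N) (u (k + m).+1).
  have [] := fS (k + m)%N; rewrite -/(u _) -/(u _) -/(ep _) -/(ep _); lra.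
have [l ul] : exists l, d (u i) l @[i --> \oo] --> (0 : R).
  apply: cd => r r0.
  have /cvgrPdist_lt/(_ (r / 4))[|N _ epN] := ep0; first by lra.
  exists N => i j Ni Nj.
  have := uD N (i - N)%N; have := uD N (j - N)%N; rewrite !subnKC//.
  have := metrizes_triangle md (u i) (u N) (u j).
  have := epN N (leqnn N); rewrite /= sub0r normrN gtr0_norm//.
  by rewrite (metrizes_sym md (u i) (u N)); lra.
have [K cK /(metrizes_nbhs md l K).1 [r r0 rK]] := lc l.
have r20 : 0 < r / 2 by lra.
have /cvgrPdist_lt/(_ _ r20) ul2 := ul.
have /cvgrPdist_lt/(_ _ r20) ep2 := ep0.
near \oo => k.
have : `|0 - d (u k) l| < r / 2 by near: k.
have : `|0 - ep k| < r / 2 by near: k.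
rewrite !sub0r !normrN gtr0_norm// ger0_norm ?(metrizes_ge0 md)// => epk uk.
have [_] := svalP (f k); apply; exists K => // y /= uy; apply: rK => /=.
have := metrizes_triangle md l (u k) y; rewrite (metrizes_sym md l (u k)).
by move: uy; rewrite -/(u k) -/(ep k); lra.
Unshelve. all: by end_near. Qed.

(** Convertible with [rdist_set] when [d] is [rdist phi g]. *)
Definition dist_to (x : T) (G : set T) : R := inf [set d x y | y in G].

Lemma dist_to_lb x (G : set T) y : G y -> dist_to x G <= d x y.
Proof.
move=> Gy; apply: ge_inf; last by exists y.
by exists 0 => _ [z _ <-]; exact: metrizes_ge0.
Qed.

(** On the compact set [K] of points of [G] far from [r x], uniqueness and compactness push the
    distance to [x] above [D + h]. If [x'] is within [h / 2] of [x], two triangle inequalities give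
    [d x (r x') < D + h], so [r x'] avoids [K]. *)
Lemma nearest_point_continuous (G : set T) (r : T -> T) :
    (forall x (s : R), precompact_set [set y | d x y < s]) -> closed G ->
    (forall x, G (r x) /\ d x (r x) = dist_to x G) ->
    (forall x y, G y -> d x y = dist_to x G -> y = r x) ->
  continuous r.
Proof.
move=> pre cG rP rU x; set D := dist_to x G.
have Dr := dist_to_lb x (rP x).1.
move=> U /= /(metrizes_nbhs md (r x) U).1 [e e0 eU].
(* Radius [D + 1] leaves room for [r x'], as [h < 1] below. *)
have [K0 cK0 K0P] := pre x (D + 1).
pose K := K0 `&` (G `&` [set y | e <= d (r x) y]).
have cK : compact K.
  apply: compact_closedI => //; apply: closedI => //.
  by apply: closed_comp (@closed_ge R e) => z _; exact: metrizes_continuous.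
have [h [h0 h1 hK]] : exists h, [/\ 0 < h, h < 1 & forall y, K y -> D + h < d x y].
  have hK : \forall h \near (0 : R)^'+, K `<=` (fun y => D + h < d x y).
    apply: (compact_near_coveringP K).1 => // y [_ [Gy /= ey]].
    have Dy : D < d x y.
      rewrite lt_neqAle dist_to_lb// andbT; apply/eqP => Dy.
      have yr := rU x y Gy (esym Dy).
      by move: ey; rewrite yr (metrizes_refl md); lra.
    (* Half of the gap absorbs the variation of [d x] near [y], the other half bounds [h]. *)
    pose m := (d x y - D) / 2.
    have m0 : 0 < m by rewrite /m; lra.
    exists ([set z | d x y - m < d x z], [set h | h < m]) => /=.
      split; last by apply: nbhs_right_lt.
      have := @metrizes_continuous x y.
      move=> /cvgrPdist_lt/(_ _ m0); apply: filterS => z /=.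
      by rewrite ltr_norml; lra.
    by move=> [z h] /= [mz hm]; move: mz hm; rewrite /m; lra.
  near (0 : R)^'+ => h; exists h; split.
  - by near: h; exact: nbhs_right_gt.
  - by near: h; exact: nbhs_right_lt.
  - by near: h.
have h2 : 0 < h / 2 by lra.
apply: (@filterS _ (nbhs x) _ _ _ _ (metrizes_ball x h2)) => x' /= dx'.
apply: eU => /=; rewrite ltNge; apply/negP => ex'.
have [Grx' rx'] := rP x'; have [Grx rx] := rP x.
have := dist_to_lb x' Grx; rewrite -rx' => rx'rx.
have := metrizes_triangle md x x' (r x'); have := metrizes_triangle md x' x (r x).
rewrite (metrizes_sym md x' x) -/D in rx * => t1 t2.
have : D + h < d x (r x').
  by apply: hK; split=> //; apply: K0P => /=; lra.
by lra.
Unshelve. all: by end_near. Qed.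

End Metric.
End MetricSpaces.

(** * Topology: retracts of a space with a global chart *)

Section Retracts.
Context {R : realType} {n : nat} {M : topologicalType} (phi : globalChart R n M).

Lemma path_connected_connected (G : set M) : path_connected R G -> connected G.
Proof.
move=> pG; have [->|/set0P[x0 Gx0]] := eqVneq G set0; first exact: connected0.
have [f fP] : {f : M -> R -> M & forall y, G y -> path_in G x0 y (f y)}.
  apply: (@choice _ _ (fun y f => G y -> path_in G x0 y f)) => y.
  have [Gy|nGy] := pselect (G y); last by exists (fun=> x0).
  by have [f fP] := pG _ _ Gx0 Gy; exists f.
have -> : G = \bigcup_(y in G) (f y @` `[0, 1]).
  apply/seteqP; split=> [y Gy|y [z Gz [t t01 <-]]].
    have [_ _ f1 _] := fP y Gy; exists y => //; exists 1 => //=.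
    by rewrite in_itv/= lexx ler01.
  by have [_ _ _] := fP z Gz; apply; rewrite inE in t01 *.
refine (bigcup_connected _ _).
  exists x0 => y Gy; have [_ f0 _ _] := fP y Gy; exists 0 => //=.
  by rewrite in_itv/= lexx ler01.
move=> y Gy; have [cf _ _ _] := fP y Gy.
by apply: connected_continuous_connected => //; exact: segment_connected.
Qed.

(** The straight segment in the chart supplies both paths and contractions of loops in [M], which a
    retraction then carries into [G]. *)
Definition chart_line (x y : M) (t : R) : M :=
  chart_inv phi ((1 - t) *: phi x + t *: phi y).

Lemma chart_line0 x y : chart_line x y 0 = x.
Proof. by rewrite /chart_line subr0 scale1r scale0r addr0 chartK. Qed.

Lemma chart_line1 x y : chart_line x y 1 = y.
Proof. by rewrite /chart_line subrr scale1r scale0r add0r chartK. Qed.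

Lemma chart_linexx x t : chart_line x x t = x.
Proof. by rewrite /chart_line -scalerDl subrK scale1r chartK. Qed.

Lemma cvg_chart_line {T : Type} (F : set_system T) {FF : Filter F}
    (f g : T -> M) (h : T -> R) x y t :
  f @ F --> x -> g @ F --> y -> h @ F --> t ->
  (fun z => chart_line (f z) (g z) (h z)) @ F --> chart_line x y t.
Proof.
move=> fx gy ht.
apply: (continuous_cvg _ (@chart_inv_continuous _ _ _ phi _)).
apply: cvgD; apply: cvgZ.
- by apply: cvgB => //; exact: cvg_cst.
- exact: (continuous_cvg _ (@chart_continuous _ _ _ phi _) fx).
- by [].
- exact: (continuous_cvg _ (@chart_continuous _ _ _ phi _) gy).
Qed.

(** A loop is contracted to its base point along chart segments, followed by [r]. The base point
    stays fixed because the segment from [x] to [x] is constant. *)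
Lemma retract_simply_connected (G : set M) (r : M -> M) : continuous r ->
  (forall x, G (r x)) -> (forall x, G x -> r x = x) -> simply_connected R G.
Proof.
move=> cr rG rid; split=> [x y Gx Gy|x f [cf f0 f1 fG]].
  exists (r \o chart_line x y); split=> /=.
  - apply: continuous_subspaceT => t; apply: (continuous_cvg _ (cr _)).
    by apply: cvg_chart_line; [exact: cvg_cst|exact: cvg_cst|exact: cvg_id].
  - by rewrite chart_line0 rid.
  - by rewrite chart_line1 rid.
  - by move=> t _; exact: rG.
have Gx : G x by rewrite -f0; apply: fG; rewrite in_itv/= lexx ler01.
exists (fun st => r (chart_line (f st.2) x st.1)); split=> /=.
- apply/subspace_continuousP => -[s t] [/= s01 t01].
  apply: (continuous_cvg _ (cr _)).
  apply: cvg_chart_line; [|exact: cvg_cst|].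
    (* The loop is continuous only within [[0, 1]], so the filter of the square is pushed by [snd]
       to the filter of [t] within that interval. *)
    move/subspace_continuousP : cf => /(_ t t01) cf.
    apply: (cvg_comp snd f _ cf) => U tU.
    have : \forall st \near (s, t), `[0, 1]%classic st.2 -> U st.2.
      exact: (@cvg_snd _ _ (nbhs s) (nbhs t) _ _ tU).
    by apply: filterS => -[s' t'] /= h [_ /h].
  by apply: cvg_within_filter; exact: (@cvg_fst _ _ (nbhs s) (nbhs t)).
- move=> s s01; split=> /=.
  + apply/subspace_continuousP => t t01.
    apply: (continuous_cvg _ (cr _)).
    apply: cvg_chart_line; [|exact: cvg_cst|exact: cvg_cst].
    by move/subspace_continuousP : cf; exact.
  + by rewrite f0 chart_linexx rid.
  + by rewrite f1 chart_linexx rid.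
  + by move=> t _; exact: rG.
- by move=> t t01; rewrite chart_line0 rid//; exact: fG.
- by move=> t _; rewrite chart_line1 rid.
Qed.

End Retracts.

(** * Continuity of the metric tensor and of the speed *)

Section Continuity.
Context {R : realType} {n : nat} (g : riemMetric R n).
Local Notation E := 'rV[R]_n.

Lemma metric_continuous i j : continuous (fun p : E => g p i j : R).
Proof. by have [] := @metric_smooth R n g i j 0. Qed.

Lemma innerE (p u v : E) :
  inner g p u v = \sum_j (\sum_i u 0 i * g p i j) * v 0 j.
Proof.
by rewrite /inner mxE; apply: eq_bigr => j _; rewrite !mxE.
Qed.

Lemma cvg_inner {T : Type} (F : set_system T) {FF : Filter F}
    (f h k : T -> E) (p u v : E) :
  f @ F --> p -> h @ F --> u -> k @ F --> v ->
  (fun t => inner g (f t) (h t) (k t)) @ F --> inner g p u v.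
Proof.
move=> fp hu kv.
have coord (l : T -> E) (w : E) i : l @ F --> w -> (fun t => l t 0 i) @ F --> w 0 i.
  exact: (continuous_cvg _ (@coord_continuous _ _ _ _ _ w)).
rewrite innerE; under eq_fun do rewrite innerE.
apply: (cvg_big (@add_continuous _)) => j _; apply: cvgM; last exact: coord.
apply: (cvg_big (@add_continuous _)) => i _; apply: cvgM; first exact: coord.
exact: (@continuous_cvg _ _ _ F _ f (fun p => g p i j) p
  (@metric_continuous i j p) fp).
Qed.

Lemma C1_continuous (e : R -> E) : C1 e -> continuous e.
Proof.
by move=> [de _] t; apply: differentiable_continuous; exact/derivable1_diffP.
Qed.

Lemma speed_continuous (e : R -> E) : C1 e -> continuous (speed g e).
Proof.
move=> ce t; apply: (continuous_cvg _ (@sqrt_continuous R _)).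
by apply: cvg_inner; [exact: C1_continuous|exact: ce.2|exact: ce.2].
Qed.

Lemma speed_ge0 (e : R -> E) t : 0 <= speed g e t.
Proof. exact: sqrtr_ge0. Qed.

End Continuity.

(** * Primitives of continuous functions on a segment *)

Section Primitives.
Context {R : realType}.

Definition primitive_on (a b : R) (F s : R -> R) : Prop :=
  forall t, a <= t <= b -> is_derive t 1 F (s t).

Lemma continuous_primitive (s : R -> R) (a b : R) : continuous s ->
  exists F : R -> R, primitive_on a b F s.
Proof.
move=> cs.
(* The margin of 1 on each side makes the derivative two-sided at [a] and [b] too. *)
have si : lebesgue_measure.-integrable `[a - 1, b + 1] (EFin \o s).
  apply: continuous_compact_integrable; first exact: segment_compact.
  exact: continuous_subspaceT.
exists (fun x => \int[lebesgue_measure]_(t in `[a - 1, x]) s t) => t /andP[at' tb].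
have tb1 : t < b + 1 by lra.
have at1 : a - 1 < t by lra.
by have [dF <-] := continuous_FTC1_closed tb1 si at1 (cs t); split; rewrite ?derive1E.
Qed.

Lemma primitive_nondecreasing (F s : R -> R) (a b : R) : a <= b ->
  primitive_on a b F s ->
  (forall t, a <= t <= b -> 0 <= s t) -> F a <= F b.
Proof.
move=> ab dF s0; apply: (@ger0_derive1_le_cc _ F a b) => //.
- move=> t /[!in_itv]/= /andP[at' tb].
  by have [] : is_derive t 1 F (s t) by apply: dF; lra.
- move=> t /[!in_itv]/= /andP[at' tb].
  have [_] : is_derive t 1 F (s t) by apply: dF; lra.
  by rewrite derive1E => ->; apply: s0; lra.
- apply: derivable_within_continuous => t /[!in_itv]/= /dF[] //.
- by rewrite in_itv/= lexx.
- by rewrite in_itv/= lexx ab.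
Qed.

Lemma Rintegral_primitive (F s : R -> R) (a b : R) : a < b -> continuous s ->
  primitive_on a b F s ->
  \int[lebesgue_measure]_(t in `[a, b]) s t = F b - F a.
Proof.
move=> ab cs dF; rewrite /Rintegral (@continuous_FTC2 _ s F a b)//.
- exact: continuous_subspaceT.
- have cF t : a <= t <= b -> {for t, continuous F}.
    by move=> /dF[dFt _]; apply: differentiable_continuous; exact/derivable1_diffP.
  split.
  + by move=> t /[!in_itv]/= tab; have [] : is_derive t 1 F (s t) by apply: dF; lra.
  + by apply: cvg_at_right_filter; apply: cF; rewrite lexx ltW.
  + by apply: cvg_at_left_filter; apply: cF; rewrite lexx ltW.
- move=> t /[!in_itv]/= tab; have [_] : is_derive t 1 F (s t) by apply: dF; lra.
  by rewrite derive1E.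
Qed.

End Primitives.

(** * Differential calculus of curves *)

Section VectorCurves.
Context {R : realType}.

Lemma is_derive_comp_curve (V : normedModType R) (e : R -> V) (h : R -> R)
    (t s : R) (v : V) :
  is_derive (h t) 1 e v -> is_derive t 1 h s -> is_derive t 1 (e \o h) (s *: v).
Proof.
move=> [de ev] [dh hs].
have de' := (derivable1_diffP _ _).1 de; have dh' := (derivable1_diffP _ _).1 dh.
split; first by apply/derivable1_diffP; exact: differentiable_comp.
rewrite deriveE; last exact: differentiable_comp.
rewrite diff_comp//=; have <- : 'D_1 h t = 'd h t 1 by rewrite deriveE.
rewrite hs.
by rewrite -[in LHS](mulr1 s) -[s * 1]/(s *: (1 : R)) linearZ/= -deriveE// ev.
Qed.

Lemma is_derive_affine (s c t : R) : is_derive t 1 (fun x => s * x + c) s.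
Proof.
have h : is_derive t 1 (s \*: id + cst c) (s *: 1 + 0).
  by apply: is_deriveD.
by apply: (is_derive_eq h); rewrite addr0; exact: mulr1.
Qed.

Lemma is_derive_reparam (V : normedModType R) (e : R -> V) (s c t : R) :
  derivable e (s * t + c) 1 ->
  is_derive t 1 (fun t => e (s * t + c)) (s *: derive1 e (s * t + c)).
Proof.
move=> de.
apply: (is_derive_comp_curve (h := fun t => s * t + c)) (is_derive_affine s c t).
by split; rewrite ?derive1E.
Qed.

Lemma is_derive_line (V : normedModType R) (x v : V) (t : R) :
  is_derive t 1 (fun t : R => x + t *: v) v.
Proof.
have [dl lE] := is_diff_scalel t v.
have h : is_derive t 1 ( *:%R ^~ v) v.
  split; first exact/derivable1_diffP.
  by rewrite deriveE// lE scale1r.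
rewrite -[X in is_derive _ _ _ X]add0r.
exact: (is_deriveD (is_derive_cst x t 1) h).
Qed.

Lemma derive1_coord (n : nat) (e : R -> 'rV[R]_n) (t : R) (i : 'I_n) :
  derivable e t 1 -> is_derive t 1 (fun t => e t 0 i) (derive1 e t 0 i).
Proof.
move=> de; split; first by move/derivable_mxP : de; exact.
by rewrite derive1E derive_mx// mxE.
Qed.

End VectorCurves.

(** * Chains of C^1 arcs and their lengths *)

Section Chains.
Context {R : realType} {n : nat} (g : riemMetric R n).
Local Notation E := 'rV[R]_n.
Implicit Types (x y z : E) (K L : R) (e : R -> E).

Lemma C1_affine e (s c : R) : C1 e -> C1 (fun t => e (s * t + c)).
Proof.
move=> [de ce]; have dE (t : R) := is_derive_reparam (de (s * t + c)).
split=> [t|]; first by have [] := dE t.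
rewrite (_ : derive1 _ = fun t => s *: derive1 e (s * t + c)); last first.
  by apply/funext => t; rewrite derive1E; have [] := dE t.
move=> t; apply: cvgZr; apply: (continuous_cvg _ (ce _)).
apply: cvgD; last exact: cvg_cst.
by apply: cvgMr; exact: cvg_id.
Qed.

Lemma speed_affine e (s c t : R) : C1 e ->
  speed g (fun t => e (s * t + c)) t = `|s| * speed g e (s * t + c).
Proof.
move=> [de _]; have [_] := is_derive_reparam (de (s * t + c)).
rewrite -derive1E /speed => ->.
rewrite /inner linearZ/= -scalemxAr -!scalemxAl scalerA mxE.
by rewrite sqrtrM ?sqr_ge0// -expr2 sqrtr_sqr.
Qed.

(* [L] is the length of [e] over [a, b], written with a primitive of the
   speed so that changes of parameter reduce to the chain rule. *)
Definition arc x y L : Prop := exists e F a b,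
  [/\ C1 e, a <= b, primitive_on a b F (speed g e) &
      [/\ e a = x, e b = y & L = F b - F a]].

(** Piecewise C^1 curves without a common parameter interval: concatenation, reversal and cutting
    become inductions. [rdist_chain] expresses [rdist] by these lengths. *)
Inductive chain : E -> E -> R -> Prop :=
| chain_nil x : chain x x 0
| chain_cons x y z K L : arc x y K -> chain y z L -> chain x z (K + L).

Lemma arc_ge0 x y L : arc x y L -> 0 <= L.
Proof.
move=> [e [F [a [b [ce ab dF [_ _ ->]]]]]]; rewrite subr_ge0.
by apply: (primitive_nondecreasing ab dF) => t _; exact: speed_ge0.
Qed.

Lemma arc_rev x y L : arc x y L -> arc y x L.
Proof.
move=> [e [F [a [b [ce ab dF [<- <- ->]]]]]].
exists (fun t => e (-1 * t + 0)), (fun t => - F (-1 * t + 0)), (- b), (- a); split.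
- exact: C1_affine.
- by rewrite lerN2.
- move=> t /andP[bt ta]; rewrite speed_affine// normrN1 mul1r.
  have dFt : is_derive (-1 * t + 0) 1 F (speed g e (-1 * t + 0)).
    by apply: dF; rewrite mulN1r addr0; lra.
  rewrite -[X in is_derive _ _ _ X]opprK -[X in is_derive _ _ _ (- X)]mulN1r.
  apply: is_deriveN.
  rewrite mulrC; apply: (is_derive1_comp (g := fun t => -1 * t + 0) dFt).
  exact: is_derive_affine.
- by rewrite !mulN1r !addr0 !opprK; split=> //; lra.
Qed.

(** The primitive of the speed is continuous, so it takes the value [F a + r] at some cutting
    parameter. *)
Lemma arc_split x y L (r : R) : arc x y L -> 0 <= r <= L ->
  exists2 z, arc x z r & arc z y (L - r).
Proof.
move=> [e [F [a [b [ce ab dF [<- <- ->]]]]]] r0L.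
have cF : {within `[a, b], continuous F}.
  by apply: derivable_within_continuous => t /[!in_itv]/= /dF[].
have Fab : F a <= F b.
  by apply: (primitive_nondecreasing ab dF) => t _; exact: speed_ge0.
have [|m /[!in_itv]/= mab Fm] := IVT (v := F a + r) ab cF.
  by rewrite min_l// max_r//; lra.
exists (e m).
- exists e, F, a, m; split=> //; first by lra.
  + by move=> t tam; apply: dF; lra.
  + by split=> //; lra.
- exists e, F, m, b; split=> //; first by lra.
  + by move=> t tam; apply: dF; lra.
  + by split=> //; lra.
Qed.

Lemma chain_ge0 x y L : chain x y L -> 0 <= L.
Proof. by elim=> // {}x {}y z K {}L /arc_ge0 K0 _ L0; exact: addr_ge0. Qed.

Lemma arc_chain x y L : arc x y L -> chain x y L.
Proof. by move=> xy; rewrite -(addr0 L); apply: chain_cons xy _; exact: chain_nil. Qed.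

Lemma chain_cat x y z K L : chain x y K -> chain y z L -> chain x z (K + L).
Proof.
move=> xy; elim: xy z L => {x y K} [x z L|x y z K K' xy _ ih w L zw].
  by rewrite add0r.
by rewrite -addrA; apply: chain_cons xy _; exact: ih.
Qed.

Lemma chain_rev x y L : chain x y L -> chain y x L.
Proof.
elim=> {x y L} [x|x y z K L xy _ ih]; first exact: chain_nil.
by rewrite addrC; apply: chain_cat ih _; exact/arc_chain/arc_rev.
Qed.

Lemma chain_split x y L (r : R) : chain x y L -> 0 <= r <= L ->
  exists2 z, chain x z r & chain z y (L - r).
Proof.
move=> xy; elim: xy r => {x y L} [x r r0|x y z K L xy yz ih r r0].
  have -> : r = 0 by lra.
  by exists x; rewrite ?subr0; exact: chain_nil.
have [rK|Kr] := leP r K.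
  have [|w xw wy] := arc_split (r := r) xy; first by lra.
  exists w; first exact: arc_chain.
  rewrite (_ : K + L - r = (K - r) + L); last by lra.
  exact: chain_cons wy yz.
have [|w yw wz] := ih (r - K); first by lra.
exists w; first by rewrite (_ : r = K + (r - K)); [exact: chain_cons xy yw|lra].
by rewrite (_ : K + L - r = L - (r - K)) //; lra.
Qed.

(** By the mean value theorem the length of a segment is its speed at one inner point, so continuity
    of the metric makes it small when [y] is close to [x]. *)
Lemma chain_line x y : exists L (t : R), [/\ chain x y L, 0 < t < 1 &
  L = Num.sqrt (inner g (x + t *: (y - x)) (y - x) (y - x))].
Proof.
pose e (t : R) : E := x + t *: (y - x).
have de (t : R) : is_derive t 1 e (y - x) by exact: is_derive_line.
have dE : derive1 e = cst (y - x).
  by apply/funext => t; rewrite derive1E; have [] := de t.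
have ce : C1 e.
  split=> [t|]; first by have [] := de t.
  by rewrite dE => t; exact: cvg_cst.
have [F dF] := @continuous_primitive R (speed g e) 0 1 (speed_continuous ce).
have [t||t t01 FE] := @MVT R F (speed g e) 0 1 ltr01.
- by move=> /[!in_itv]/= t01; apply: dF; lra.
- by apply: derivable_within_continuous => t /[!in_itv]/= /dF[].
exists (F 1 - F 0), t; split=> //.
- apply: arc_chain; exists e, F, 0, 1; split=> //.
  by rewrite /e scale0r scale1r addr0 addrC subrK.
- by rewrite FE subr0 mulr1 /speed dE.
Qed.

End Chains.

(** * Local lower bound of the metric by the norm of the chart *)

Section Coercivity.
Context {R : realType} {n : nat} (g : riemMetric R n).
Local Notation E := 'rV[R]_n.

(** The metric norm is positive on the compact unit sphere, hence bounded below there uniformly for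
    base points near [p]; homogeneity gives all [v]. *)
Lemma inner_coercive (p : E) : exists2 c : R, 0 < c &
  \forall z \near p, forall v : E, c * `|v| <= Num.sqrt (inner g z v v).
Proof.
pose S := [set v : E | `|v| = 1].
have cS : compact S.
  refine (bounded_closed_compact _ _).
    by exists 1; split; [exact: num_real|move=> x x1 v /= ->; exact: ltW].
  exact: (closed_comp (fun v _ => @norm_continuous R E v) (@closed_eq R 1)).
(* Letting the bound [c] tend to 0 together with the base point tending to [p] turns both
   uniformities into one covering argument. *)
have hS : \forall zc \near filter_prod (nbhs p) (0 : R)^'+,
    S `<=` (fun v => zc.2 < Num.sqrt (inner g zc.1 v v)).
  refine ((compact_near_coveringP S).1 cS (E * R)%type _
    (fun zc v => zc.2 < Num.sqrt (inner g zc.1 v v)) _ _) => v Sv.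
  have gv : 0 < Num.sqrt (inner g p v v).
    rewrite sqrtr_gt0; apply: metric_pos; rewrite -normr_gt0 Sv; exact: ltr01.
  pose m := Num.sqrt (inner g p v v) / 2.
  have m0 : 0 < m by rewrite /m; lra.
  have : (fun vz : E * E => Num.sqrt (inner g vz.2 vz.1 vz.1)) @ (v, p)
      --> Num.sqrt (inner g p v v).
    apply: (continuous_cvg _ (@sqrt_continuous R _)).
    by apply: cvg_inner; [exact: cvg_snd|exact: cvg_fst|exact: cvg_fst].
  move=> /cvgrPdist_lt/(_ _ m0) [[A B] /= [vA pB] AB].
  exists (A, [set zc | B zc.1 /\ zc.2 < m]) => /=.
    split=> //; exists (B, [set c | c < m]) => /=; last by case=> z c [].
    by split=> //; apply: nbhs_right_lt.
  move=> [v' [z c]] /= [Av' [Bz cm]].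
  have := AB (v', z) (conj Av' Bz); rewrite /= ltr_norml; move: cm; rewrite /m; lra.
case: hS => -[A B] /= [pA B0 AB].
have [c c0 Bc] : exists2 c : R, 0 < c & B c.
  near (0 : R)^'+ => c; exists c; first by near: c; exact: nbhs_right_gt.
  by near: c.
exists c => //; apply: filterS pA => z Az v.
have [->|v0] := eqVneq v 0; first by rewrite normr0 mulr0 sqrtr_ge0.
have nv0 : 0 < `|v| by rewrite normr_gt0.
have := AB (z, c) (conj Az Bc) (`|v|^-1 *: v); rewrite /S /=.
rewrite normrZ normfV normr_id mulVf ?gt_eqF// => /(_ erefl) /ltW.
rewrite /inner linearZ/= -scalemxAr -!scalemxAl scalerA mxE.
have iv0 : 0 <= `|v|^-1 by rewrite invr_ge0 ltW.
rewrite sqrtrM -expr2 ?sqr_ge0// sqrtr_sqr ger0_norm//.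
by rewrite [_^-1 * _]mulrC ler_pdivlMr.
Unshelve. all: by end_near. Qed.

End Coercivity.

(** * Short curves stay close to their origin in the chart *)

Section Bump.
Context {R : realType} {n : nat} (g : riemMetric R n).
Local Notation E := 'rV[R]_n.

Lemma coord_le_norm (v : E) i : `|v 0 i| <= `|v|.
Proof.
rewrite [leRHS]/Num.Def.normr/= mx_normrE.
exact: (le_bigmax _ (fun ij : 'I_1 * 'I_n => `|v ij.1 ij.2|) (0, i)).
Qed.

Lemma norm_lt_coord (v : E) (r : R) : 0 < r ->
  (forall i, `|v 0 i| < r) -> `|v| < r.
Proof.
move=> r0 vr; rewrite /Num.Def.normr/= mx_normrE; apply/bigmax_ltP; split=> //.
by case=> i j _; rewrite (ord1 i); exact: vr.
Qed.

Lemma is_derive_pos_part_sqr (x : R) :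
  is_derive x 1 (fun x : R => Num.max 0 x ^+ 2) (2 * Num.max 0 x).
Proof.
have dsq : is_derive x 1 (fun x : R => x ^+ 2) (2 * x).
  apply: (is_derive_eq (is_deriveX 2 (is_derive_id x 1))).
  by rewrite /= expr1; exact: mulr1.
have [x0|x0|<-] := ltgtP 0 x.
- apply: (near_eq_is_derive _ dsq); near=> y.
  by rewrite max_r// ltW//; near: y; exact: lt_nbhsr.
- rewrite mulr0; apply: (near_eq_is_derive _ (is_derive_cst 0 x 1)); near=> y.
  rewrite max_l ?expr0n//= ltW//; near: y; exact: lt_nbhsl.
(* At the kink, the difference quotient is bounded by [|h|]. *)
- have h0 : (fun h : R => h^-1 * (Num.max 0 (h * 1 + 0) ^+ 2 - Num.max 0 0 ^+ 2))
     @ 0^' --> (0 : R).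
    apply/cvgr0Pnorm_le => e e0; near=> h.
    have h0 : h != 0 by near: h; exact: nbhs_dnbhs_neq.
    have he : `|h| <= e by near: h; exact: dnbhs0_le.
    rewrite addr0 maxxx expr0n/= subr0 mulr1.
    apply: le_trans he; rewrite normrM normfV ler_pdivrMl ?normr_gt0//.
    rewrite normrX -expr2 lerXn2r ?nnegrE//.
    by case: (leP 0 h) => _; rewrite ?normr0.
  by rewrite mulr0; split; [apply/cvg_ex; exists 0|exact: cvg_lim].
Unshelve. all: by end_near. Qed.

(** The norm of [E] is the sup norm, which is not smooth; the squared Euclidean distance is
    polynomial and dominates its square. *)
Definition sqdist (p z : E) : R := \sum_(i < n) (z 0 i - p 0 i) ^+ 2.

(* Squaring the positive part makes this C^1. As it is constant away from [p],
   its variation along any curve is controlled by the length of the curve, even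
   though the metric is only controlled near [p]. *)
Definition bump (p : E) (r : R) (z : E) : R :=
  Num.max 0 (r ^+ 2 - sqdist p z) ^+ 2.

Lemma sqdist_lt (p z : E) (r : R) : 0 < r -> sqdist p z < r ^+ 2 -> `|z - p| < r.
Proof.
move=> r0 zr; apply: norm_lt_coord => // i.
rewrite -(@ltr_pXn2r _ 2) ?nnegrE ?(ltW r0)// -normrX ger0_norm ?sqr_ge0//.
apply: le_lt_trans zr; rewrite /sqdist (bigD1 i)//= !mxE lerDl.
by apply: sumr_ge0 => j _; exact: sqr_ge0.
Qed.

Lemma is_derive_bump (p : E) (r : R) (e : R -> E) (t : R) : derivable e t 1 ->
  is_derive t 1 (fun t => bump p r (e t))
    (2 * Num.max 0 (r ^+ 2 - sqdist p (e t)) *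
     - (\sum_(i < n) 2 * (e t 0 i - p 0 i) * derive1 e t 0 i)).
Proof.
move=> de.
have dc i : is_derive t 1 (fun t => (e t 0 i - p 0 i) ^+ 2)
    (2 * (e t 0 i - p 0 i) * derive1 e t 0 i).
  have h := is_deriveB (derive1_coord i de) (is_derive_cst (p 0 i) t 1).
  apply: (is_derive_eq (is_deriveX 2 h)).
  by rewrite /= expr1 subr0.
have ds : is_derive t 1 (fun t => sqdist p (e t))
    (\sum_(i < n) 2 * (e t 0 i - p 0 i) * derive1 e t 0 i).
  have := is_derive_sum dc; congr is_derive.
  by apply/funext => s; rewrite fct_sumE.
have dd := is_deriveB (is_derive_cst (r ^+ 2) t 1) ds.
apply: (is_derive_eq (is_derive1_comp (is_derive_pos_part_sqr _) dd)).
by rewrite sub0r.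
Qed.

(** Where the bump varies, its derivative along [e] is [2 * u] times a sum of [n] terms, with
    [u <= r ^+ 2] and each term at most [2 * r] times the norm of the velocity, itself at most the
    speed over [c]. *)
Lemma chain_bump (p : E) (r c : R) : 0 < r -> 0 < c ->
    (forall z, `|z - p| < r -> forall v : E, c * `|v| <= Num.sqrt (inner g z v v)) ->
  forall x y L, chain g x y L ->
  bump p r x - bump p r y <= (4 * n%:R * r ^+ 3 / c) * L.
Proof.
move=> r0 c0 coer x y L; set K := _ / c.
elim=> {x y L} [x|x y z L L' xy _ ih]; first by rewrite subrr mulr0.
suff : bump p r x - bump p r y <= K * L by rewrite mulrDr; lra.
case: xy => e [F [a [b [ce ab dF [<- <- ->]]]]].
have dG t : a <= t <= b -> is_derive t 1 (fun t => bump p r (e t) + K * F t)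
    (2 * Num.max 0 (r ^+ 2 - sqdist p (e t)) *
     - (\sum_(i < n) 2 * (e t 0 i - p 0 i) * derive1 e t 0 i) + K * speed g e t).
  move=> tab; have dFt := dF t tab.
  exact: (is_deriveD (is_derive_bump p r (ce.1 t)) (is_deriveZ K dFt)).
(* As [F] measures length, the bound amounts to monotonicity of the bump plus [K * F]. *)
suff : bump p r (e a) + K * F a <= bump p r (e b) + K * F b by lra.
apply: (primitive_nondecreasing ab dG) => t tab.
have K0 : 0 <= K by rewrite /K divr_ge0 ?mulr_ge0 ?exprn_ge0 ?ler0n ?ltW.
have [ut|ut] := leP (r ^+ 2 - sqdist p (e t)) 0.
  by rewrite mulr0 mul0r add0r mulr_ge0// speed_ge0.
set u := _ - _; have u0 : 0 < u by [].
have er : `|e t - p| < r by apply: sqdist_lt => //; lra.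
have ur : u <= r ^+ 2.
  rewrite /u gerBl; apply: sumr_ge0 => i _; exact: sqr_ge0.
set s := \sum_(i < n) _.
have hs : `|s| <= n%:R * (2 * r * `|derive1 e t|).
  apply: (le_trans (ler_norm_sum _ _ _)).
  rewrite [leRHS](_ : _ = \sum_(i < n) 2 * r * `|derive1 e t|); last first.
    by rewrite sumr_const card_ord mulr_natl.
  apply: ler_sum => i _.
  rewrite !normrM ger0_norm// ler_pM// ?ler_pM// ?coord_le_norm//.
  by rewrite (le_trans _ (ltW er))// (le_trans _ (coord_le_norm _ i))// !mxE.
have := coer _ er (derive1 e t); rewrite -/(speed g e t) => hc.
have hc' : `|derive1 e t| <= speed g e t / c by rewrite ler_pdivlMr// mulrC.
have h1 : `|2 * u * - s| <= K * speed g e t.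
  rewrite normrM normrN ger0_norm; last by lra.
  apply: (@le_trans _ _ (2 * r ^+ 2 * (n%:R * (2 * r * (speed g e t / c))))).
    apply: ler_pM => //; [lra|lra|apply: (le_trans hs)].
    by rewrite ler_wpM2l// ler_wpM2l//; lra.
  rewrite le_eqVlt; apply/orP; left; apply/eqP.
  by rewrite /K; field; rewrite gt_eqF.
by move: h1; rewrite ler_norml; lra.
Qed.

(** The bump falls from [r ^+ 4] at [p] to 0 at Euclidean distance [r], which costs a definite
    length. *)
Lemma chain_small (p : E) (eps : R) : 0 < eps ->
  exists2 d : R, 0 < d & forall y L, chain g p y L -> L < d -> `|y - p| < eps.
Proof.
move=> e0; have [c c0 /nbhs_ballP[r' /= r'0 cr']] := inner_coercive g p.
pose r := Num.min r' eps.
have r0 : 0 < r by rewrite /r lt_min r'0.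
have coer z : `|z - p| < r -> forall v : E, c * `|v| <= Num.sqrt (inner g z v v).
  move=> zp; apply: cr'; rewrite -ball_normE /= distrC (lt_le_trans zp)//.
  by rewrite /r ge_min lexx.
pose K := 4 * n%:R * r ^+ 3 / c.
have K0 : 0 <= K by rewrite /K divr_ge0 ?mulr_ge0 ?exprn_ge0 ?ler0n ?ltW.
(* [K] vanishes when [n = 0], whence the denominator [K + 1]. *)
exists (r ^+ 4 / (K + 1)); first by rewrite divr_gt0 ?exprn_gt0//; lra.
move=> y L pyL; rewrite ltr_pdivlMr; last by lra.
move=> Lr.
suff : `|y - p| < r by move/lt_le_trans; apply; rewrite /r ge_min lexx orbT.
apply: sqdist_lt => //; rewrite ltNge; apply/negP => ry.
have := chain_bump r0 c0 coer pyL; rewrite -/K /bump.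
have -> : sqdist p p = 0 by apply: big1 => i _; rewrite subrr expr0n.
rewrite subr0 [Num.max 0 (r ^+ 2)]max_r ?sqr_ge0// max_l; last by lra.
rewrite expr0n/= subr0 -exprM => h.
have L0 := chain_ge0 pyL.
by move: h Lr; rewrite mulrDr mulr1 (mulrC L K); lra.
Qed.

End Bump.

(** * Piecewise C^1 curves and chains have the same lengths *)

Section Pieces.
Context {R : realType} {n : nat} (g : riemMetric R n).
Local Notation E := 'rV[R]_n.
Local Notation mu := lebesgue_measure.
Implicit Types (c e : R -> E) (a b : R) (s : seq R).

Lemma eq_speed_oo c e a b : {in `[a, b], c =1 e} ->
  {in `]a, b[, speed g c =1 speed g e}.
Proof.
move=> ce t tab; have ct : c t = e t.
  by apply: ce; move: tab; rewrite !in_itv/=; lra.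
rewrite /speed ct !derive1E (@near_eq_derive _ _ _ c e)//.
near=> u; apply: ce; have : u \in `]a, b[ by near: u; exact: near_in_itvoo.
by rewrite !in_itv/=; lra.
Unshelve. all: by end_near. Qed.

(** An inductive form of [piecewise_C1] carrying the length; it mediates between the integral in
    [arc_length] and [chain]. *)
Inductive pieces c : R -> seq R -> R -> Prop :=
| pieces_nil a : pieces c a [::] 0
| pieces_cons a b s e F L : a < b -> C1 e -> {in `[a, b], c =1 e} ->
    primitive_on a b F (speed g e) -> pieces c b s L ->
    pieces c a (b :: s) (F b - F a + L).

Lemma pieces_le_last c a s L : pieces c a s L -> a <= last a s.
Proof. by elim=> // {}a b {}s e F {}L ab _ _ _ _; apply: le_trans; exact: ltW. Qed.

Lemma pieces_integral c a s L : pieces c a s L ->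
  measurable_fun `[a, last a s] (speed g c) /\
  (\int[mu]_(t in `[a, last a s]) (speed g c t)%:E = L%:E)%E.
Proof.
elim=> {a s L} [a|a b s e F L ab Ce ce dF bs [mbs IL]] /=.
  by rewrite set_itv1; split; [exact: measurable_fun_set1|rewrite integral_set1].
have bl := pieces_le_last bs.
have ce' := eq_speed_oo ce.
have mse : measurable_fun `]a, b[ (speed g e).
  apply: measurable_funTS.
  exact: (continuous_measurable_fun (speed_continuous (g := g) Ce)).
have moo : measurable_fun `]a, b[ (speed g c).
  apply: (@eq_measurable_fun _ _ _ _ _ (speed g e)).
    by move=> t; rewrite inE/= => tab; rewrite ce'.
  exact: mse.
have -> : `[a, last b s]%classic = `[a, b[ `|` `[b, last b s].
  by apply: itv_bndbnd_setU; rewrite bnd_simp//; exact: ltW.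
have mab : measurable_fun `[a, b[ (speed g c).
  exact/measurable_fun_itv_obnd_cbndP.
have mU : measurable_fun (`[a, b[ `|` `[b, last b s]) (speed g c).
  by apply/measurable_funU.
split=> //; rewrite ge0_integral_setU//=; last 3 first.
- exact/measurable_EFinP.
- by move=> t _; rewrite lee_fin speed_ge0.
- apply/disj_setPS => t [] /=; rewrite !in_itv/=; lra.
(* End points are negligible, and on the open interval the speeds of [c] and [e] agree. *)
- rewrite IL integral_itv_bndoo; last exact/measurable_EFinP.
  rewrite (_ : (\int[mu]_(z in `]a, b[) _ = (F b - F a)%:E)%E)//.
  rewrite -(Rintegral_primitive ab (speed_continuous (g := g) Ce) dF).
  rewrite /Rintegral fineK; last first.
    apply: integrable_fin_num => //.
    apply: continuous_compact_integrable; first exact: segment_compact.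
    exact: (continuous_subspaceT (speed_continuous (g := g) Ce)).
  have /measurable_EFinP mse' := mse.
  have -> := integral_itv_bndoo true false mse'.
  by apply: eq_integral => t; rewrite inE/= => tab; rewrite ce'.
Qed.

Lemma pieces_arc_length c a s L : pieces c a s L -> arc_length g a (last a s) c = L.
Proof. by move=> /pieces_integral[_]; rewrite /arc_length /Rintegral => ->. Qed.

Lemma pieces_chain c a s L : pieces c a s L -> chain g (c a) (c (last a s)) L.
Proof.
elim=> {a s L} [a|a b s e F L ab Ce ce dF _ ih] /=; first exact: chain_nil.
apply: chain_cons ih; exists e, F, a, b; split=> //; first exact: ltW.
by split=> //; rewrite ce// in_itv/= lexx ltW.
Qed.

Lemma pieces_path c a s L : pieces c a s L -> path <%R a s.
Proof. by elim=> //= {}a b {}s e F {}L -> _ _ _ _ ->. Qed.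

Lemma pieces_eq c d a s L : {in `[a, last a s], c =1 d} -> pieces c a s L ->
  pieces d a s L.
Proof.
move=> cd cs; elim: cs cd => {a s L} [a _|a b s e F L ab Ce ce dF bs ih cd].
  exact: pieces_nil.
have bl := pieces_le_last bs.
apply: (pieces_cons ab Ce) => //; last first.
  by apply: ih => t /[!in_itv]/= tb; apply: cd; rewrite in_itv/=; lra.
move=> t tab; rewrite -ce// cd//; move: tab; rewrite !in_itv/=; lra.
Qed.

Lemma pieces_piecewise c a s L : pieces c a s L -> piecewise_C1 a (last a s) c.
Proof.
move=> cs; exists s; first by split; [exact: pieces_path cs|].
move: (last a s) => b0.
elim: cs => {a s L} [//|a b s e F L ab Ce ce dF bs ih] [_|i /=]; last exact: ih.
by exists e.
Qed.

Lemma piecewise_pieces c a b : piecewise_C1 a b c ->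
  exists s L, last a s = b /\ pieces c a s L.
Proof.
move=> [s [sp /eqP sb] sc].
suff [L cL] : exists L, pieces c a s L by exists s, L.
elim: s a sp sc {sb} => [|x s ih] a /=.
  by move=> _ _; exists 0; exact: pieces_nil.
move=> /andP[ax xs] sc.
have [L cL] := ih x xs (fun i => sc i.+1).
have [e Ce ce] := sc 0 isT.
have [F dF] := continuous_primitive a x (speed_continuous (g := g) Ce).
by exists (F x - F a + L); exact: pieces_cons Ce ce dF cL.
Qed.

Lemma chain_pieces x y L : chain g x y L ->
  exists c a s, [/\ pieces c a s L, c a = x & c (last a s) = y].
Proof.
elim=> {x y L} [x|x y z K L xy _ [c [a [s [cs ca cl]]]]].
  by exists (fun=> x), 0, [::]; split=> //; exact: pieces_nil.
case: xy => e [F [a1 [b1 [Ce ab dF [ea eb ->]]]]].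
(* An arc over a single point has length 0 and is dropped, since pieces require [a < b]. *)
have [ab1|ab1|ab1] := ltgtP a1 b1; last 2 first.
- by move: ab; rewrite leNgt ab1.
- by exists c, a, s; rewrite ab1 subrr add0r ca -eb -ab1 ea.
(* The new arc is translated by [k] so as to end at [a], where the rest begins. *)
pose k := b1 - a; pose a' := a1 - k.
pose f (t : R) := e (1 * t + k).
pose h t := if t < a then f t else c t.
pose H (t : R) := F (1 * t + k).
exists h, a', (a :: s).
have a'a : a' < a by rewrite /a' /k; lra.
have al := pieces_le_last cs.
split.
- have -> : F b1 - F a1 = H a - H a'.
    by congr (F _ - F _); rewrite /a' /k; lra.
  refine (@pieces_cons h a' a s f H L a'a (C1_affine 1 k Ce) _ _ _).
  + move=> t /[!in_itv]/= /andP[_]; rewrite le_eqVlt /h => /orP[/eqP ->|->//].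
    by rewrite ltxx ca /f /k mul1r addrC subrK.
  + move=> t tab; rewrite speed_affine// normr1 mul1r.
    rewrite -[X in is_derive _ _ _ X]mulr1.
    apply: (is_derive1_comp (g := fun t => 1 * t + k)); last exact: is_derive_affine.
    by apply: dF; move: tab; rewrite /a' /k; lra.
  + apply: pieces_eq cs => t /[!in_itv]/= tl.
    by rewrite /h ltNge; case/andP: tl => ->.
- by rewrite /h a'a /f /a' mul1r subrK.
- by rewrite /h /= ltNge al.
Qed.

End Pieces.

(** * The Riemannian distance is a length metric inducing the topology *)

Section RiemannianDistance.
Context {R : realType} {n : nat} {M : topologicalType}.
Context (phi : globalChart R n M) (g : riemMetric R n).
Implicit Types (x y z : M) (L : R).

Lemma rdist_chain x y : rdist phi g x y = inf [set L | chain g (phi x) (phi y) L].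
Proof.
congr inf; apply/seteqP; split=> [L [a [b [c [pc <- <- ->]]]]|L /= /chain_pieces].
  have [s [L' [sb cL]]] := piecewise_pieces g pc.
  by rewrite -sb (pieces_arc_length cL); exact: (pieces_chain cL).
move=> [c [a [s [cs ca cl]]]].
have cE : phi \o (chart_inv phi \o c) = c.
  by apply/funext => t /=; rewrite chart_invK.
exists a, (last a s), (chart_inv phi \o c); rewrite cE; split.
- exact: pieces_piecewise cs.
- by rewrite /= ca chartK.
- by rewrite /= cl chartK.
- by rewrite (pieces_arc_length cs).
Qed.

Lemma rdist_le x y L : chain g (phi x) (phi y) L -> rdist phi g x y <= L.
Proof.
move=> xy; rewrite rdist_chain; apply: ge_inf => //.
by exists 0 => K; exact: chain_ge0.
Qed.

Lemma rdist_lt x y (r : R) : rdist phi g x y < r ->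
  exists2 L, chain g (phi x) (phi y) L & L < r.
Proof.
(* The straight segment shows that the set of lengths is nonempty. *)
rewrite rdist_chain => xr; have [L [t [xy _ _]]] := chain_line g (phi x) (phi y).
have [||K xyK Kr] := @inf_adherent _ [set L | chain g (phi x) (phi y) L]
  (r - inf [set L | chain g (phi x) (phi y) L]).
- by rewrite subr_gt0.
- by split; [exists L|exists 0 => K; exact: chain_ge0].
- by exists K => //; rewrite addrC subrK in Kr.
Qed.

Lemma rdist_ge0 x y : 0 <= rdist phi g x y.
Proof.
rewrite leNgt; apply/negP => /rdist_lt[L /chain_ge0]; lra.
Qed.

Lemma rdist_triangle x y z : rdist phi g x z <= rdist phi g x y + rdist phi g y z.
Proof.
apply/ler_addgt0Pr => e e0.
have e2 : 0 < e / 2 by lra.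
have [|K xy Ke] := @rdist_lt x y (rdist phi g x y + e / 2); first by lra.
have [|L yz Le] := @rdist_lt y z (rdist phi g y z + e / 2); first by lra.
by have := rdist_le (chain_cat xy yz); lra.
Qed.

Lemma rdist_metrizes : metrizes (rdist phi g).
Proof.
have d_le x y : rdist phi g y x <= rdist phi g x y.
  apply/ler_addgt0Pr => e e0.
  have [|K xy Ke] := @rdist_lt x y (rdist phi g x y + e); first by lra.
  by have := rdist_le (chain_rev xy); lra.
have dxx x : rdist phi g x x = 0.
  by apply/eqP; rewrite eq_le rdist_ge0 andbT rdist_le//; exact: chain_nil.
split=> //.
- exact: rdist_ge0.
- by move=> x y; apply/eqP; rewrite eq_le !d_le.
- exact: rdist_triangle.
move=> x U; split=> [xU|[e e0 eU]].
  have := @chart_inv_continuous _ _ _ phi (phi x) U.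
  rewrite chartK => /(_ xU) /nbhs_ballP[e /= e0 eU].
  have [d d0 dU] := chain_small g (phi x) e0.
  exists d => // y /= /rdist_lt[L xy Ld]; rewrite -(chartK phi y).
  apply: eU; rewrite -ball_normE /= distrC; exact: dU xy Ld.
apply: filterS eU _.
(* The converse inclusion: the metric norm is continuous at the zero vector over [phi x], so
   segments to nearby points are short. *)
have h : (fun zv : 'rV[R]_n * 'rV[R]_n => Num.sqrt (inner g zv.1 zv.2 zv.2))
    @ (phi x, 0 : 'rV[R]_n) --> (0 : R).
  rewrite -[X in _ --> X](_ : Num.sqrt (inner g (phi x) 0 0) = 0); last first.
    by rewrite /inner mul0mx mul0mx mxE sqrtr0.
  apply: (continuous_cvg _ (@sqrt_continuous R _)).
  by apply: cvg_inner; [exact: cvg_fst|exact: cvg_snd|exact: cvg_snd].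
move/cvgrPdist_lt : h => /(_ _ e0) [[A B] /= [/nbhs_ballP[r1 /= r10 r1A]]].
move=> /nbhs_ballP[r2 /= r20 r2B] AB.
pose r := Num.min r1 r2; have r0 : 0 < r by rewrite lt_min r10 r20.
have hr : \forall y \near x, `|phi y - phi x| < r.
  have /cvgrPdist_lt/(_ _ r0) := @chart_continuous _ _ _ phi x.
  by apply: filterS => y; rewrite distrC.
apply: filterS hr => y yr /=.
have [L [t [xyL t01 LE]]] := chain_line g (phi x) (phi y).
apply: le_lt_trans (rdist_le xyL) _.
have := AB (phi x + t *: (phi y - phi x), phi y - phi x).
rewrite /= sub0r normrN ger0_norm ?sqrtr_ge0// -LE; apply; split.
- apply: r1A; rewrite -ball_normE /= opprD addrA subrr sub0r normrN normrZ.
  rewrite gtr0_norm; last by lra.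
  have : r <= r1 by rewrite ge_min lexx.
  have : t * `|phi y - phi x| <= `|phi y - phi x| by rewrite ler_piMl//; lra.
  by lra.
- apply: r2B; rewrite -ball_normE /= sub0r normrN (lt_le_trans yr)//.
  by rewrite ge_min lexx orbT.
Qed.

Lemma rdist_eq0 x y : rdist phi g x y = 0 -> x = y.
Proof.
move=> xy0; apply: (can_inj (chartK phi)); apply/eqP; rewrite eq_sym -subr_eq0.
apply: contraT => nxy; have e0 : 0 < `|phi y - phi x| by rewrite normr_gt0.
have [d d0 dxy] := chain_small g (phi x) e0.
have [|L xyL Ld] := @rdist_lt x y d; first by rewrite xy0.
by have := dxy _ _ xyL Ld; rewrite ltxx.
Qed.

Lemma rdist_length_space : length_space (rdist phi g).
Proof.
move=> x y r s r0 s0 /rdist_lt[L xy Lrs].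
have L0 := chain_ge0 xy.
(* Cutting in the ratio of [r] to [s] leaves parts shorter than [r] and [s], because [L < r + s]. *)
pose k := L * r / (r + s).
have rs0 : 0 < r + s by lra.
have kr : k < r by rewrite /k ltr_pdivrMr// [r * _]mulrC ltr_pM2r.
have ks : L - k < s.
  have -> : L - k = L * s / (r + s) by rewrite /k; field; rewrite gt_eqF.
  by rewrite ltr_pdivrMr// [s * _]mulrC ltr_pM2r.
have k0 : 0 <= k <= L.
  rewrite /k divr_ge0 ?mulr_ge0 ?(ltW r0) ?(ltW rs0)//=.
  by rewrite ler_pdivrMr// ler_wpM2l//; lra.
have [z xz zy] := chain_split xy k0.
exists (chart_inv phi z).
- by apply: le_lt_trans (rdist_le _) kr; rewrite chart_invK.
- by apply: le_lt_trans (rdist_le _) ks; rewrite chart_invK.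
Qed.

End RiemannianDistance.

(** * Local compactness and the conclusion *)

Lemma globalChart_locally_compact (R : realType) (n : nat) (M : topologicalType)
    (phi : globalChart R n M) (x : M) : exists2 K, compact K & nbhs x K.
Proof.
pose B := closed_ball (phi x) (1 : R).
have BE : B = closed_ball_ Num.norm (phi x) 1 by rewrite /B closed_ballE.
exists (chart_inv phi @` B).
  apply: continuous_compact.
    exact: (continuous_subspaceT (@chart_inv_continuous _ _ _ phi)).
  refine (bounded_closed_compact _ (@closed_ball_closed _ _ _ _)).
  exists (1 + `|phi x|); split; [exact: num_real|move=> t xt v /=].
  rewrite -/B BE /closed_ball_/= distrC => vx.
  rewrite -(subrK (phi x) v); apply: (le_trans (ler_normD _ _)).
  by apply: le_trans (ltW xt); rewrite lerD2r.
have /cvgrPdist_lt/(_ _ ltr01) := @chart_continuous _ _ _ phi x.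
apply: filterS => y /ltW yx.
by exists (phi y); [rewrite BE|rewrite chartK].
Qed.

Theorem corollary2p1 (R : realType) (n : nat) (M : topologicalType)
    (phi : globalChart R n M) (g : riemMetric R n)
    (g_complete : rcomplete phi g)
    (g_curvature : exists k : R, sectional_between g (- k ^+ 2) 0)
    (G : set M) (G_nonempty : G !=set0) (G_wconvex : weakly_convex phi g G) :
  connected G /\ simply_connected R G.
Proof.
have [cG uG _] := G_wconvex.
have md := rdist_metrizes phi g.
have pre := cohn_vossen md (@rdist_length_space _ _ _ phi g) g_complete
  (globalChart_locally_compact phi).
have projG x : G x -> is_projection phi g G x x.
  move=> Gx; split=> //; apply/eqP; rewrite eq_le; apply/andP; split.
    rewrite (metrizes_refl md); apply: lb_le_inf; first by exists (rdist phi g x x), x.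
    by move=> _ [y _ <-]; exact: metrizes_ge0.
  exact: (dist_to_lb md x Gx).
(* Outside [G] this is the unique projection of weak convexity; on [G] the distance to [G] is 0 and
   [rdist_eq0] gives uniqueness. *)
have ex x : exists y, is_projection phi g G x y /\
    forall z, is_projection phi g G x z -> z = y.
  have [Gx|nGx] := pselect (G x); last first.
    by have [y [py uy]] := uG x nGx; exists y; split=> // z /uy.
  exists x; split=> [|z [Gz]]; first exact: projG.
  rewrite -(projG x Gx).2 (metrizes_refl md) => xz.
  exact/esym/(rdist_eq0 xz).
have [r rP] := choice ex.
have cr : continuous r.
  apply: (nearest_point_continuous md pre cG).
  - by move=> x; exact: (rP x).1.
  - by move=> x y Gy xy; apply: (rP x).2.
have sG : simply_connected R G.
  apply: (retract_simply_connected phi cr) => [x|x Gx]; first exact: (rP x).1.1.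
  by apply/esym; apply: (rP x).2; exact: projG.
by split=> //; exact: (path_connected_connected sG.1).
Qed.
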